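(* Let $\Gamma$ be an additive subgroup of $\mathbb{R}$, let $E,F$ be finite disjoint sets, and let $\mathsf{A}$ be a valuated bimatroid on rows $E$ and columns $F$ with minor valuation function $\mu_{\mathsf{A}}\colon\binom{E}{\ast}\times\binom{F}{\ast}\to\overline{\Gamma}$. Fix $0<q\leq1$ and set $$R_k(\mathsf{A}):=\sum_{(I,J)\in\binom{E}{k}\times\binom{F}{k}} q^{\mu_{\mathsf{A}}(I,J)}\qquad(k\geq0),$$ with the convention $q^\infty=0$. Then for every integer $N\geq\min\{|E|,|F|\}$ and every $k\ge 1$, $$\frac{R_k(\mathsf{A})^2}{\binom{N}{k}^2}\ \geq\ \frac{R_{k+1}(\mathsf{A})}{\binom{N}{k+1}}\cdot\frac{R_{k-1}(\mathsf{A})}{\binom{N}{k-1}},$$ i.e. the sequence $(R_k(\mathsf{A}))_k$ is ultra log-concave.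
   Context: $\overline{\Gamma}=\Gamma\sqcup\{\infty\}$ with $\infty$ larger than every element of $\Gamma$. $\binom{E}{k}$ is the set of $k$-element subsets of $E$; $\binom{E}{\ast}\times\binom{F}{\ast}$ is the set of pairs $(I,J)$ with $I\subseteq E$, $J\subseteq F$, $|I|=|J|$. A valuated matroid of rank $r$ on a finite set $X$ is a map $\nu\colon\binom{X}{r}\to\overline{\Gamma}$, not identically $\infty$, such that for all $S,T\in\binom{X}{r}$ and $s\in S- T$ there is $t\in T- S$ with $\nu(S)+\nu(T)\geq\nu(S-\{s\}\cup\{t\})+\nu(T-\{t\}\cup\{s\})$. A valuated bimatroid on rows $E$ and columns $F$ is a map $\mu_{\mathsf{A}}\colon\binom{E}{\ast}\times\binom{F}{\ast}\to\overline{\Gamma}$ such that the map $\nu_{\widehat{\mathsf{A}}}\colon\binom{E\sqcup F}{|E|}\to\overline{\Gamma}$, $\nu_{\widehat{\mathsf{A}}}(S)=\mu_{\mathsf{A}}(E- S,\,S\cap F)$, is a valuated matroid of rank $|E|$ on $E\sqcup F$ with $\nu_{\widehat{\mathsf{A}}}(E)=0$. Binomial coefficients $\binom{N}{j}$ with $j>N$ are $0$ (only $N$, $k$ with nonzero denominators are meant). *)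

(* Defs.v *)
From HB Require Import structures.
From mathcomp Require Import all_boot all_order all_algebra.
From mathcomp Require Import reals exp.
Set Implicit Arguments. Unset Strict Implicit. Unset Printing Implicit Defensive.
Import Order.TTheory GRing.Theory Num.Theory.
Local Open Scope ring_scope.

(* Gamma-bar = Gamma ⊔ {oo} is modelled as option R: Some x = x, None = oo. *)
Section Defs.
Variable R : realType.

Definition additive_subgroup (G : R -> Prop) : Prop :=
  G 0 /\ (forall x y, G x -> G y -> G (x - y)).

Definition oadd (a b : option R) : option R :=
  match a, b with Some x, Some y => Some (x + y) | _, _ => None end.

Definition ole (a b : option R) : bool :=
  match a, b with
  | _, None => true
  | None, Some _ => false
  | Some x, Some y => x <= y
  end.

Definition valuated_matroid (G : R -> Prop) (X : finType) (r : nat)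
    (nu : {set X} -> option R) : Prop :=
  (forall S : {set X}, #|S| = r -> forall x, nu S = Some x -> G x) /\
  (exists S : {set X}, #|S| = r /\ nu S <> None) /\
  (forall S T : {set X}, #|S| = r -> #|T| = r ->
     forall s, s \in S :\: T -> exists2 t, t \in T :\: S &
       ole (oadd (nu (t |: (S :\ s))) (nu (s |: (T :\ t))))
           (oadd (nu S) (nu T))).

Definition bimatroid_nu (E F : finType) (mu : {set E} -> {set F} -> option R)
    (S : {set (E + F)%type}) : option R :=
  mu (~: (inl @^-1: S)) (inr @^-1: S).

(* valuated bimatroid on rows E and columns F (E, F disjoint via the sum type) *)
Definition valuated_bimatroid (G : R -> Prop) (E F : finType)
    (mu : {set E} -> {set F} -> option R) : Prop :=
  valuated_matroid G #|E| (bimatroid_nu mu) /\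
  bimatroid_nu mu [set inl e | e : E] = Some 0.

Definition qpow (q : R) (a : option R) : R :=
  match a with Some x => q `^ x | None => 0 end.

Definition Rk (E F : finType) (mu : {set E} -> {set F} -> option R) (q : R)
    (k : nat) : R :=
  \sum_(I : {set E} | #|I| == k) \sum_(J : {set F} | #|J| == k) qpow q (mu I J).
End Defs.

(* Main.v *)
(* The weight w(S) = q^nu(S) on the subsets S of E + F inherits from nu the
   exchange inequality w(S) w(T) <= w(S - s + t) w(T - t + s).  Let f be the
   generating polynomial sum_S w(S) z^S, of degree d = |E|.  For nonnegative
   directions u_3, ..., u_d the quadratic form
   H(x, y) = D_x D_y D_{u_3} ... D_{u_d} f satisfies the reverse Cauchy-Schwarz
   inequality H(x, x) H(u, u) <= H(x, u)^2 for u >= 0, that is, f is Lorentzian.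
   This is proved by induction on d.  In rank 2 the exchange inequality makes the
   matrix w({i, j}), after rescaling its rows and columns, an ultrametric, which
   is negative semidefinite on vectors of sum zero.  In higher rank,
   H = sum_k u_{3,k} H_k where each H_k comes from a contraction of w, and the
   inequalities for the H_k trickle down to H because basis exchange makes the
   graph of H connected.  Taking every u_i among the indicators of E and F turns
   the inequality into ultra log-concavity of R_k with N = |E|; the dual weight
   w(~: S) gives N = |F|, and larger N only weakens the claim. *)

Require Import Defs.
From HB Require Import structures.
From mathcomp Require Import all_boot all_order all_algebra.
From mathcomp Require Import reals exp.
From mathcomp Require boolp.
From mathcomp Require Import ring lra.
Set Implicit Arguments. Unset Strict Implicit. Unset Printing Implicit Defensive.
Import Order.TTheory GRing.Theory Num.Theory.
Local Open Scope ring_scope.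

(** * Quadratic forms, reverse Cauchy-Schwarz and ultrametrics *)

Section Forms.
Variables (R : realFieldType) (X : finType).
Implicit Types (h : X -> X -> R) (x y z u v : X -> R).

Definition app h x i : R := \sum_j h i j * x j.
Definition bil h x y : R := \sum_i x i * app h y i.
Definition lorentzian h : Prop := forall x u, (forall i, 0 <= u i) ->
  bil h x x * bil h u u <= bil h x u ^+ 2.

Lemma appD h a b x y i :
  app h (fun j => a * x j + b * y j) i = a * app h x i + b * app h y i.
Proof.
rewrite /app !mulr_sumr -big_split /=; apply: eq_bigr => j _; ring.
Qed.

Lemma bilDl h a b x y v :
  bil h (fun j => a * x j + b * y j) v = a * bil h x v + b * bil h y v.
Proof.
rewrite /bil !mulr_sumr -big_split /=; apply: eq_bigr => j _; ring.
Qed.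

Lemma bilDr h a b x y v :
  bil h v (fun j => a * x j + b * y j) = a * bil h v x + b * bil h v y.
Proof.
rewrite /bil !mulr_sumr -big_split /=; apply: eq_bigr => j _; rewrite appD; ring.
Qed.

Lemma bilC h x y : (forall i j, h i j = h j i) -> bil h x y = bil h y x.
Proof.
move=> hC; rewrite /bil /app.
under eq_bigr do rewrite mulr_sumr.
rewrite exchange_big /=; apply: eq_bigr => i _.
rewrite mulr_sumr; apply: eq_bigr => j _; rewrite hC; ring.
Qed.

Lemma bil_ge0 h x y : (forall i j, 0 <= h i j) -> (forall i, 0 <= x i) ->
  (forall i, 0 <= y i) -> 0 <= bil h x y.
Proof.
move=> h0 x0 y0; apply: sumr_ge0 => i _; apply: mulr_ge0 => //.
by apply: sumr_ge0 => j _; apply: mulr_ge0.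
Qed.

(** The vector [a x + b u] with [a = bil h u z], [b = - bil h x z] is orthogonal to [z], so the form
    is nonpositive on it. Multiplying by [bil h u u] and completing the square leaves [a ^+ 2] times
    the claim. *)
Lemma reverse_cauchy h z x u : (forall i j, h i j = h j i) ->
  (forall v, bil h v z = 0 -> bil h v v <= 0) ->
  bil h u z != 0 -> 0 < bil h u u ->
  bil h x x * bil h u u <= bil h x u ^+ 2.
Proof.
move=> hC hz uz uu.
set a := bil h u z; set b := - bil h x z.
have /hz : bil h (fun j => a * x j + b * u j) z = 0.
  by rewrite bilDl /a /b; ring.
rewrite bilDl !bilDr (bilC u x hC) => H.
have a2 : 0 < a ^+ 2 by rewrite exprn_even_gt0.
rewrite -subr_ge0 -(pmulr_rge0 _ a2).
have := sqr_ge0 (b * bil h u u + a * bil h x u).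
have := mulr_ge0_le0 (ltW uu) H.
lra.
Qed.

(* Splitting [A] at its largest value, all cross terms take that value. *)
Lemma ultrametric_form (M : X -> X -> R) (y : X -> R) (n : nat) :
  forall (A : {set X}) (c : R), (#|A| <= n)%N ->
  (forall i, i \in A -> M i i = 0) ->
  (forall i j, i \in A -> j \in A -> M i j = M j i) ->
  (forall i j k, i \in A -> j \in A -> k \in A ->
     M i j <= Num.max (M i k) (M k j)) ->
  0 <= c -> (forall i j, i \in A -> j \in A -> M i j <= c) ->
  \sum_(i in A) \sum_(j in A) M i j * (y i * y j) <= c * (\sum_(i in A) y i) ^+ 2.
Proof.
elim: n => [|n IH] A c.
  rewrite leqn0 cards_eq0 => /eqP-> *.
  by rewrite !big_set0 expr0n /= mulr0.
move=> cA M0 MC MU c0 Mc.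
have [->|[a0 a0A]] := set_0Vmem A.
  by rewrite !big_set0 expr0n /= mulr0.
pose P (p : X * X) := (p.1 \in A) && (p.2 \in A).
have Pa : P (a0, a0) by rewrite /P /= a0A.
case: (@Order.TotalTheory.arg_maxP _ R _ _ P (fun p => M p.1 p.2) Pa) => -[a b] /andP[/= aA bA] mx.
set m := M a b.
have mle i j : i \in A -> j \in A -> M i j <= m.
  by move=> iA jA; apply: (mx (i, j)); rewrite /P /= iA.
have m0 : 0 <= m by rewrite -(M0 _ a0A) mle.
have mc : m <= c by apply: Mc.
apply: (@le_trans _ _ (m * (\sum_(i in A) y i) ^+ 2)); last first.
  by rewrite ler_wpM2r // sqr_ge0.
have [m_eq0|mN0] := eqVneq m 0.
  rewrite m_eq0 mul0r big1 // => i iA; rewrite big1 // => j jA.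
  suff -> : M i j = 0 by rewrite mul0r.
  apply/eqP; rewrite eq_le -{1}m_eq0 mle //=.
  by have := MU _ _ _ iA iA jA; rewrite M0 // (MC j i) // maxxx.
have mp : 0 < m by rewrite lt_def mN0.
(* [B] is the open ball of radius [m] about [a], and [C] the rest of [A]. Since [a] lies in [B] and
   [b] in [C], both are smaller than [A]. *)
pose B := [set j in A | M a j < m].
pose C := [set j in A | ~~ (M a j < m)].
have BA i : i \in B -> i \in A by rewrite inE => /andP[].
have CA i : i \in C -> i \in A by rewrite inE => /andP[].
have MBC i j : i \in B -> j \in C -> M i j = m.
  move=> iB jC; apply/eqP; rewrite eq_le mle ?(BA i) ?(CA j) //=.
  have := MU a j i aA (CA _ jC) (BA _ iB).
  move: iB jC; rewrite !inE => /andP[_ ai] /andP[_]; rewrite -leNgt => aj.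
  move=> /(le_trans aj); rewrite le_max => /orP[|//].
  by rewrite leNgt ai.
have split f : \sum_(i in A) f i = \sum_(i in B) f i + \sum_(i in C) f i :> R.
  rewrite (bigID (fun j => M a j < m)) /=.
  by congr (_ + _); apply: eq_bigl => i; rewrite inE.
have ltcard (D : {set X}) k : {subset D <= A} -> k \in A -> k \notin D ->
    (#|D| <= n)%N.
  move=> DA kA kD; rewrite -ltnS; apply: leq_trans cA; apply: proper_card.
  apply/properP; split; first by apply/subsetP.
  by exists k.
have HB : \sum_(i in B) \sum_(j in B) M i j * (y i * y j) <= m * (\sum_(i in B) y i) ^+ 2.
  apply: IH => //.
  - by apply: (@ltcard B b) => //; rewrite inE bA /= -/m ltxx.
  - by move=> i /BA; apply: M0.
  - by move=> i j /BA ? /BA ?; apply: MC.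
  - by move=> i j k /BA ? /BA ? /BA ?; apply: MU.
  - by move=> i j /BA ? /BA ?; apply: mle.
have HC : \sum_(i in C) \sum_(j in C) M i j * (y i * y j) <= m * (\sum_(i in C) y i) ^+ 2.
  apply: IH => //.
  - by apply: (@ltcard C a) => //; rewrite inE aA M0 // mp.
  - by move=> i /CA; apply: M0.
  - by move=> i j /CA ? /CA ?; apply: MC.
  - by move=> i j k /CA ? /CA ? /CA ?; apply: MU.
  - by move=> i j /CA ? /CA ?; apply: mle.
rewrite split.
under eq_bigr do rewrite split.
under [X in _ + X <= _]eq_bigr do rewrite split.
rewrite !big_split /= split.
have -> : \sum_(i in B) \sum_(j in C) M i j * (y i * y j) =
    m * (\sum_(i in B) y i) * (\sum_(i in C) y i).
  rewrite mulr_sumr exchange_big /=; apply: eq_bigr => j jC.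
  rewrite mulr_sumr mulr_suml; apply: eq_bigr => i iB.
  rewrite MBC //; ring.
have -> : \sum_(i in C) \sum_(j in B) M i j * (y i * y j) =
    m * (\sum_(i in B) y i) * (\sum_(i in C) y i).
  rewrite mulr_sumr; apply: eq_bigr => i iC.
  rewrite mulr_sumr mulr_suml; apply: eq_bigr => j jB.
  rewrite (MC i j) ?(CA i) ?(BA j) // MBC //; ring.
move: HB HC; lra.
Qed.
End Forms.

(** The columns of [cokermx A] are kernel vectors of [L], so they kill [b], which puts [b] in the
    row space; symmetry turns rows into columns. This solves the Laplacian equation in
    [trickle_down]. *)
Lemma fredholm (R : fieldType) (X : finType) (L : X -> X -> R) (b : X -> R) :
  (forall i j, L i j = L j i) ->
  (forall y, (forall i, \sum_j L i j * y j = 0) -> \sum_i b i * y i = 0) ->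
  exists y, forall i, \sum_j L i j * y j = b i.
Proof.
move=> LC Lb.
pose A := \matrix_(i < #|X|, j < #|X|) L (enum_val i) (enum_val j).
pose B := \row_(j < #|X|) b (enum_val j).
have sumE (F : X -> R) : \sum_i F i = \sum_(i < #|X|) F (enum_val i).
  by rewrite -[RHS](big_enum_val F); apply: eq_bigl.
have /submxP[D /rowP BD] : (B <= A)%MS.
  rewrite submxE; apply/eqP/rowP => k; rewrite !mxE.
  have := Lb (fun i => cokermx A (enum_rank i) k).
  rewrite sumE; under eq_bigr do rewrite enum_valK.
  move=> H; under eq_bigr do rewrite mxE; apply: H => i.
  have /matrixP/(_ (enum_rank i) k) := mulmx_coker A; rewrite !mxE => E.
  rewrite sumE -[RHS]E; apply: eq_bigr => j _.
  by rewrite [A _ _]mxE enum_valK enum_rankK.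
exists (fun i => D 0 (enum_rank i)) => i.
have := BD (enum_rank i); rewrite !mxE enum_rankK => ->.
rewrite sumE; apply: eq_bigr => j _.
by rewrite !mxE enum_rankK enum_valK LC mulrC.
Qed.

(** * Lorentzian forms: the rank 2 case and the inductive step *)

Section Induction.
Variables (R : realFieldType) (X : finType).
Implicit Types (h : X -> X -> R) (x y z u v : X -> R).

(** For symmetric [h] this is the multiplicative four-point condition: the largest of the three
    products is attained at least twice. *)
Definition pluecker h : Prop := forall i j k l,
  h i j * h k l <= Num.max (h i k * h j l) (h i l * h j k).

(** By [reverse_cauchy] with [z] a unit vector [e], it suffices to bound the form on vectors killed
    by one nonzero row [n]. On the support [V] of that row, dividing by [h n i * h n j] gives an
    ultrametric; the rows outside [V] are multiples of row [n] and drop out. *)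
Lemma pluecker_lorentzian h : (forall i j, h i j = h j i) ->
  (forall i j, 0 <= h i j) -> (forall i, h i i = 0) -> pluecker h ->
  lorentzian h.
Proof.
move=> hC h0 hd hP x u u0.
have [uu|] := ltP 0 (bil h u u); last first.
  have := bil_ge0 h0 u0 u0 => ge le.
  by rewrite (@le_anti _ _ (bil h u u) 0) ?ge ?le // mulr0 sqr_ge0.
have [n un] : exists n, app h u n != 0.
  have [n nu|H] := pickP (fun n => app h u n != 0); first by exists n.
  move: uu; rewrite /bil big1 ?ltxx // => i _.
  by have /negbFE/eqP-> := H i; rewrite mulr0.
pose e i : R := (i == n)%:R.
have bile v : bil h v e = app h v n.
  rewrite /bil /app; apply: eq_bigr => i _.
  rewrite (bigD1 n) //= big1 ?addr0 => [|j /negbTE jn]; last first.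
    by rewrite /e jn mulr0.
  by rewrite /e eqxx mulr1 mulrC hC.
have [k nk] : exists k, 0 < h n k.
  have [k k0|H] := pickP (fun k => 0 < h n k); first by exists k.
  move: un; rewrite /app big1 ?eqxx // => j _.
  have := H j; rewrite lt_neqAle h0 andbT => /negbFE/eqP <-.
  by rewrite mul0r.
apply: (@reverse_cauchy _ _ h e) => //; last by rewrite bile.
move=> {x u u0 uu un} x; rewrite bile => xn.
pose V := [set i | 0 < h n i].
have VP i : i \in V -> 0 < h n i by rewrite inE.
have VN i : i \notin V -> h n i = 0.
  by rewrite inE lt_neqAle h0 andbT negbK => /eqP.
have hV i j : i \notin V -> h i j = h i k / h n k * h n j.
  move=> /VN ni.
  have E a b : h i a * h n b <= h i b * h n a.
    have := hP i a n b; rewrite [h i n]hC ni mul0r (hC a n) le_max => /orP[|//].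
    by move=> /le_trans; apply; apply: mulr_ge0.
  have : h i j * h n k = h i k * h n j.
    by apply/le_anti; rewrite !E.
  by move=> H; apply: (mulIf (lt0r_neq0 nk)); rewrite H; field; apply: lt0r_neq0.
have appV i : i \notin V -> app h x i = 0.
  move=> iV; rewrite /app; under eq_bigr do rewrite (hV i _ iV) -mulrA.
  by rewrite -mulr_sumr -/(app h x n) xn mulr0.
have hVV i j : i \notin V -> j \notin V -> h i j = 0.
  by move=> iV jV; rewrite hV // (VN j) // mulr0.
have bilV : bil h x x = \sum_(i in V) \sum_(j in V) h i j * (x i * x j).
  rewrite /bil (bigID (mem V)) /= [X in _ + X]big1 ?addr0; last first.
    by move=> i iV; rewrite appV // mulr0.
  have -> : \sum_(i in V) x i * app h x i = \sum_j \sum_(i in V) h i j * (x i * x j).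
    rewrite exchange_big /=; apply: eq_bigr => i _.
    by rewrite /app mulr_sumr; apply: eq_bigr => j _; ring.
  rewrite (bigID (mem V)) /= [X in _ + X]big1 ?addr0; last first.
    move=> j jV.
    have := appV j jV; rewrite /app (bigID (mem V)) /= [X in _ + X]big1 ?addr0.
      move=> E; transitivity (x j * \sum_(i in V) h j i * x i).
        by rewrite mulr_sumr; apply: eq_bigr => i _; rewrite (hC i); ring.
      by rewrite E mulr0.
    by move=> i iV; rewrite hVV // mul0r.
  exact: exchange_big.
(* In the rescaled coordinates [y], the condition [app h x n = 0] becomes sum zero on [V]. *)
pose M i j := h i j / (h n i * h n j).
pose y i := h n i * x i.
have sy : \sum_(i in V) y i = 0.
  rewrite -[RHS]xn /app [RHS](bigID (mem V)) /= [X in _ + X]big1 ?addr0 //.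
  by move=> i /VN->; rewrite mul0r.
have -> : bil h x x = \sum_(i in V) \sum_(j in V) M i j * (y i * y j).
  rewrite bilV; apply: eq_bigr => i /VP iV; apply: eq_bigr => j /VP jV.
  by rewrite /M /y; field; rewrite !lt0r_neq0.
(* Any upper bound of [M] will do, as it gets multiplied by a zero sum. *)
pose c := \sum_i \sum_j `|M i j|.
have := @ultrametric_form R X M y #|V| V c (leqnn _).
rewrite sy expr0n /= mulr0; apply.
- by move=> i _; rewrite /M hd mul0r.
- by move=> i j _ _; rewrite /M hC [h n i * _]mulrC.
- move=> i j l /VP iV /VP jV /VP lV.
  have p : 0 < h n i * h n j * h n l by rewrite !mulr_gt0.
  rewrite -(ler_pM2r p) maxr_pMl ?(ltW p) //.
  have -> : M i j * (h n i * h n j * h n l) = h i j * h l n.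
    by rewrite /M (hC l n); field; rewrite !lt0r_neq0.
  have -> : M i l * (h n i * h n j * h n l) = h i l * h j n.
    by rewrite /M (hC j n); field; rewrite !lt0r_neq0.
  have -> : M l j * (h n i * h n j * h n l) = h i n * h j l.
    by rewrite /M (hC i n) (hC j l); field; rewrite !lt0r_neq0.
  exact: hP.
- by apply: sumr_ge0 => i _; apply: sumr_ge0.
- move=> i j _ _; rewrite /c (bigD1 i) //= (bigD1 j) //= -addrA.
  rewrite -[leLHS]addr0 lerD ?ler_norm // addr_ge0 //; first exact: sumr_ge0.
  by apply: sumr_ge0 => a _; apply: sumr_ge0.
Qed.

(* With [H = sum_k z_k H_k] and [D = diag ((H z)_i / z_i)], the hypotheses on
   the slices [H_k] say that [D^-1 H] has no eigenvalue in the open interval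
   (0, 1), while the Laplacian [D - H] is positive semidefinite with kernel
   spanned by [z]: only one positive eigenvalue is left. *)
Lemma trickle_down (t : X -> X -> X -> R) z :
  (forall i j k, t i j k = t j i k) -> (forall i j k, t i j k = t i k j) ->
  (forall i j k, 0 <= t i j k) -> (forall i, 0 < z i) ->
  let h i j := \sum_k z k * t k i j in
  (forall i j a b, 0 < h i a -> 0 < h j b ->
     0 < h i j \/ exists2 k, 0 < h i k & 0 < h k j) ->
  (forall k, lorentzian (t k)) -> lorentzian h.
Proof.
move=> t12 t23 t0 z0 h conn tL.
have hC i j : h i j = h j i by apply: eq_bigr => k _; rewrite t23.
have h0 i j : 0 <= h i j.
  by apply: sumr_ge0 => k _; apply: mulr_ge0; rewrite // ltW.
have z0' i : 0 <= z i by apply: ltW.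
have tz k y : bil (t k) y z = app h y k.
  rewrite bilC //.
  rewrite /bil /app /h.
  under [RHS]eq_bigr do rewrite mulr_suml.
  rewrite exchange_big /=; apply: eq_bigr => i _.
  rewrite /app mulr_sumr; apply: eq_bigr => j _; rewrite t12; ring.
have hz0 i : 0 <= app h z i by apply: sumr_ge0 => j _; apply: mulr_ge0.
pose D i := app h z i / z i.
have D0 i : 0 <= D i by rewrite divr_ge0.
have DZ i : D i * z i = app h z i by rewrite /D divfK // lt0r_neq0.
have D_pos i : 0 < D i -> exists j, 0 < h i j.
  move=> Di; have [j hj|H] := pickP (fun j => 0 < h i j); first by exists j.
  move: Di; rewrite /D /app big1 ?mul0r ?ltxx // => j _.
  have := H j; rewrite lt_neqAle h0 andbT => /negbFE/eqP <-.
  by rewrite mul0r.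
have bilE y : bil h y y = \sum_k z k * bil (t k) y y.
  rewrite /bil /app /h.
  under [RHS]eq_bigr do rewrite mulr_sumr.
  rewrite [RHS]exchange_big /=; apply: eq_bigr => i _.
  rewrite !mulr_sumr.
  under [RHS]eq_bigr do rewrite !mulr_sumr.
  rewrite [RHS]exchange_big /=; apply: eq_bigr => j _.
  rewrite mulr_suml mulr_sumr; apply: eq_bigr => k _; ring.
(* Reverse Cauchy-Schwarz for the slice [t k] against [z], read through [tz]. *)
have slice y k : D k * (z k * bil (t k) y y) <= app h y k ^+ 2.
  have := tL k y z z0'; rewrite !tz mulrA DZ; lra.
have slice0 y k : D k = 0 -> bil (t k) y y = 0.
  move=> Dk; have /eqP : app h z k = 0 by rewrite -DZ Dk mul0r.
  rewrite /app psumr_eq0 => [/allP H|j _]; last by rewrite mulr_ge0.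
  have hk j : h k j = 0.
    have /eqP/eqP := H j (mem_index_enum j).
    by rewrite mulf_eq0 (negbTE (lt0r_neq0 (z0 j))) orbF => /eqP.
  have tk i j : t k i j = 0.
    move/eqP: (hk j); rewrite /h psumr_eq0 => [/allP K|l _]; last by rewrite mulr_ge0.
    have /eqP/eqP := K i (mem_index_enum i).
    by rewrite mulf_eq0 (negbTE (lt0r_neq0 (z0 i))) orFb t12 => /eqP.
  by rewrite /bil big1 // => i _; rewrite /app big1 ?mulr0 // => j _; rewrite tk mul0r.
(* In the coordinates [y i / z i], [D - H] is a weighted graph Laplacian, hence a sum of squares
   over edges. *)
have lapl y : \sum_i D i * y i ^+ 2 - bil h y y =
    2^-1 * \sum_i \sum_j h i j * (z i * z j) * (y i / z i - y j / z j) ^+ 2.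
  have E1 : \sum_i \sum_j h i j * z j / z i * y i ^+ 2 = \sum_i D i * y i ^+ 2.
    apply: eq_bigr => i _; rewrite /D /app !mulr_suml; apply: eq_bigr => j _; ring.
  have E2 : \sum_i \sum_j h i j * z i / z j * y j ^+ 2 = \sum_i D i * y i ^+ 2.
    rewrite -E1 exchange_big /=; apply: eq_bigr => i _; apply: eq_bigr => j _.
    by rewrite hC.
  have E3 : \sum_i \sum_j h i j * y i * y j = bil h y y.
    rewrite /bil /app; apply: eq_bigr => i _; rewrite mulr_sumr.
    apply: eq_bigr => j _; ring.
  have -> : \sum_i \sum_j h i j * (z i * z j) * (y i / z i - y j / z j) ^+ 2 =
     \sum_i D i * y i ^+ 2 + \sum_i D i * y i ^+ 2 - 2 * bil h y y.
    rewrite -{1}E1 -E2 -E3 mulr_sumr -!sumrN -!big_split /=.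
    apply: eq_bigr => i _; rewrite mulr_sumr -!sumrN -!big_split /=.
    by apply: eq_bigr => j _; field; rewrite !lt0r_neq0.
  by field.
have lapl_term y i j : 0 <= h i j * (z i * z j) * (y i / z i - y j / z j) ^+ 2.
  by apply: mulr_ge0; [rewrite !mulr_ge0|exact: sqr_ge0].
have lapl_ge0 y : bil h y y <= \sum_i D i * y i ^+ 2.
  rewrite -subr_ge0 lapl mulr_ge0 ?invr_ge0 // sumr_ge0 // => i _.
  exact: sumr_ge0.
pose L i j := (i == j)%:R * D i - h i j.
have LE y i : \sum_j L i j * y j = D i * y i - app h y i.
  rewrite /L /app; under eq_bigr do rewrite mulrBl.
  rewrite sumrB (bigD1 i) //= eqxx mul1r big1 ?addr0 // => j.
  by rewrite eq_sym => /negbTE->; rewrite !mul0r.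
have LC i j : L i j = L j i.
  by rewrite /L hC; case: eqVneq => [->//|_]; rewrite !mul0r.
(* Kernel vectors have [y i / z i] constant along edges, and [conn] joins any two non-isolated
   vertices by a path of length at most two. *)
have ker y : (forall i, \sum_j L i j * y j = 0) ->
    exists c, forall i, 0 < D i -> y i = c * z i.
  move=> Ly.
  have yy : \sum_i D i * y i ^+ 2 - bil h y y = 0.
    rewrite /bil -sumrB big1 // => i _.
    have := Ly i; rewrite LE => E.
    by transitivity (y i * 0); [rewrite -E; ring | rewrite mulr0].
  have adj i j : 0 < h i j -> y i / z i = y j / z j.
    move=> hij; move/eqP: yy; rewrite lapl mulf_eq0 invr_eq0 pnatr_eq0 /=.
    rewrite psumr_eq0 => [/allP H|a _]; last exact: sumr_ge0.
    have /eqP/eqP := H i (mem_index_enum i).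
    rewrite psumr_eq0 => [/allP K|//].
    have /eqP/eqP := K j (mem_index_enum j).
    have p : 0 < h i j * (z i * z j) by rewrite !mulr_gt0.
    by rewrite mulf_eq0 (negbTE (lt0r_neq0 p)) /= sqrf_eq0 subr_eq0 => /eqP.
  have [i0 Di0|H] := pickP (fun i => 0 < D i); last first.
    by exists 0 => i; rewrite H.
  exists (y i0 / z i0) => i Di.
  have [a ha] := D_pos _ Di0; have [b hb] := D_pos _ Di.
  have -> : y i0 / z i0 = y i / z i.
    by have [/adj|[k /adj-> /adj]] := conn _ _ _ _ ha hb.
  by rewrite divfK // lt0r_neq0.
have main x : bil h x z = 0 -> bil h x x <= 0.
  move=> xz.
  (* Solve [(D - H) y = D x]. The right-hand side is orthogonal to the kernel, since its pairing
     with [c z] is [c * bil h x z = 0]. *)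
  have [|y Ly] := fredholm (b := fun i => D i * x i) LC.
    move=> y /ker [c yc].
    transitivity (c * bil h x z); last by rewrite xz mulr0.
    rewrite /bil mulr_sumr; apply: eq_bigr => i _.
    have := D0 i; rewrite le_eqVlt => /orP[/eqP Di|/yc ->].
      by rewrite -DZ -Di !mul0r !mulr0.
    rewrite -DZ; ring.
  have yE i : app h y i = D i * (y i - x i).
    by have := Ly i; rewrite LE; lra.
  have le : bil h y y <= \sum_i D i * (y i - x i) ^+ 2.
    rewrite bilE; apply: ler_sum => k _.
    have := D0 k; rewrite le_eqVlt => /orP[/eqP Dk|Dk].
      by rewrite slice0 // -Dk mulr0 mul0r.
    rewrite -(ler_pM2l Dk); apply: le_trans (slice y k) _.
    by rewrite yE le_eqVlt; apply/orP; left; apply/eqP; ring.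
  (* Positivity of the Laplacian at [x - y] gives [bil h x x <= bil h x y], while the slice bound
     [le] amounts to [bil h x y <= 0]. *)
  have := lapl_ge0 (fun i => 1 * x i + -1 * y i).
  rewrite bilDl !bilDr (bilC y x hC).
  have yyE : bil h y y = \sum_i D i * y i ^+ 2 - \sum_i D i * (x i * y i).
    rewrite /bil -sumrB; apply: eq_bigr => i _; rewrite yE; ring.
  have xyE : bil h x y = \sum_i D i * (x i * y i) - \sum_i D i * x i ^+ 2.
    rewrite /bil -sumrB; apply: eq_bigr => i _; rewrite yE; ring.
  have -> : \sum_i D i * (1 * x i + -1 * y i) ^+ 2 =
     \sum_i D i * x i ^+ 2 + \sum_i D i * y i ^+ 2
       - 2 * \sum_i D i * (x i * y i).
    rewrite mulr_sumr -sumrN -!big_split /=; apply: eq_bigr => i _; ring.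
  have E : \sum_i D i * (y i - x i) ^+ 2 =
     \sum_i D i * x i ^+ 2 + \sum_i D i * y i ^+ 2
       - 2 * \sum_i D i * (x i * y i).
    rewrite mulr_sumr -sumrN -!big_split /=; apply: eq_bigr => i _; ring.
  move: le; rewrite E yyE xyE; lra.
move=> x u u0.
have [uu|le] := ltP 0 (bil h u u).
  apply: (reverse_cauchy x hC main) => //.
  by apply/eqP => /main; rewrite leNgt uu.
have ge := bil_ge0 h0 u0 u0.
by rewrite (@le_anti _ _ (bil h u u) 0) ?ge ?le // mulr0 sqr_ge0.
Qed.
End Induction.

(** * Derivatives of multiaffine polynomials and weights with exchange *)

Section Derivatives.
Variables (R : realFieldType) (X : finType).
Implicit Types (w : {set X} -> R) (u v x y : X -> R) (S T : {set X}).
Implicit Types (us vs : seq (X -> R)).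

(* A weight [w] stands for the multiaffine polynomial [sum_S w(S) z^S];
   [contract k] is the partial derivative in [z_k], taken at [S] as the
   coefficient of [z^S], and [pder u] the derivative in direction [u]. *)
Definition contract k w S : R := if k \in S then 0 else w (k |: S).
Definition pder u w S : R := \sum_k u k * contract k w S.
Definition hess w i j : R := contract i (contract j w) set0.

(** The multiplicative form of a valuated matroid of rank [d]. The zero weight is allowed, so that
    contracting a loop stays in the class. *)
Definition mconcave w d : Prop :=
  [/\ forall S, 0 <= w S, forall S, 0 < w S -> #|S| = d &
      forall S T s, 0 < w S -> 0 < w T -> s \in S :\: T ->
        exists2 t, t \in T :\: S &
          w S * w T <= w (t |: (S :\ s)) * w (s |: (T :\ t))].

Lemma contractC i j w : contract i (contract j w) = contract j (contract i w).
Proof.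
apply/boolp.funext => S; rewrite /contract !in_setU1 (eq_sym j i) setUCA.
by case: (i \in S); case: (j \in S); case: (i == j).
Qed.

Lemma contract_pder k u w : contract k (pder u w) = pder u (contract k w).
Proof.
apply/boolp.funext => S; rewrite /pder.
under [RHS]eq_bigr do rewrite contractC.
rewrite {1}/contract; case: ifP => kS.
  by rewrite big1 // => i _; rewrite /contract kS mulr0.
by apply: eq_bigr => i _; rewrite /(contract k) kS.
Qed.

Lemma pderC u v w : pder u (pder v w) = pder v (pder u w).
Proof.
apply/boolp.funext => S; rewrite /(pder u) /(pder v).
under eq_bigr do rewrite -/(pder v w) contract_pder mulr_sumr.
rewrite exchange_big /=; apply: eq_bigr => i _.
rewrite -/(pder u w) contract_pder mulr_sumr; apply: eq_bigr => j _.
by rewrite contractC mulrCA.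
Qed.

Lemma contract_foldr k us w :
  contract k (foldr pder w us) = foldr pder (contract k w) us.
Proof. by elim: us => //= u us <-; rewrite contract_pder. Qed.

Lemma pder_foldr u us w : pder u (foldr pder w us) = foldr pder (pder u w) us.
Proof. by elim: us => //= v us <-; rewrite pderC. Qed.

Lemma hessC w i j : hess w i j = hess w j i.
Proof. by rewrite /hess contractC. Qed.

Lemma hessE w i j : hess w i j = if i == j then 0 else w [set i; j].
Proof.
by rewrite /hess /contract in_set0 !in_setU1 in_set0 orbF eq_sym setU0 setUC.
Qed.

Lemma bil_hess w x y : bil (hess w) x y = pder x (pder y w) set0.
Proof.
rewrite /bil /pder; apply: eq_bigr => i _; rewrite -/(pder y w) contract_pder.
by congr (_ * _); apply: eq_bigr => j _; rewrite mulrC /hess contractC.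
Qed.

Lemma contract_ge0 k w : (forall S, 0 <= w S) -> forall S, 0 <= contract k w S.
Proof. by move=> w0 S; rewrite /contract; case: ifP. Qed.

Lemma pder_ge0 u w : (forall i, 0 <= u i) -> (forall S, 0 <= w S) ->
  forall S, 0 <= pder u w S.
Proof.
by move=> u0 w0 S; apply: sumr_ge0 => k _; rewrite mulr_ge0 ?contract_ge0.
Qed.

Lemma foldr_pder_ge0 us w : List.Forall (fun u => forall i, 0 <= u i) us ->
  (forall S, 0 <= w S) -> forall S, 0 <= foldr pder w us S.
Proof.
by elim: us => //= u us IH /List.Forall_cons_iff[u0 us0] w0; apply/pder_ge0/IH.
Qed.

Lemma Forall_pos_ge0 us : List.Forall (fun u => forall i, 0 < u i) us ->
  List.Forall (fun u => forall i, 0 <= u i) us.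
Proof. by apply: List.Forall_impl => u u0 i; apply: ltW. Qed.

(** Positive directions and nonnegative weights rule out cancellation. The graph of the Hessian can
    thus be read off the bases. *)
Lemma foldr_pder_gt0 us w S : List.Forall (fun u => forall i, 0 < u i) us ->
  (forall S, 0 <= w S) ->
  0 < foldr pder w us S <->
  exists T, [/\ S \subset T, #|T| = (#|S| + size us)%N & 0 < w T].
Proof.
move=> + w0; elim: us S => [|u us IH] S /=.
  move=> _; split=> [wS|[T [ST cT wT]]]; first by exists S; rewrite addn0.
  suff -> : S = T by [].
  by apply/eqP; rewrite eqEcard ST cT addn0 leqnn.
move=> /List.Forall_cons_iff[u0 us0].
have G0 := foldr_pder_ge0 (Forall_pos_ge0 us0) w0.
have u0' i : 0 <= u i by apply: ltW.
split=> [p|[T [ST cT wT]]].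
  have [k kp|H] := pickP (fun k => 0 < contract k (foldr pder w us) S).
    move: kp; rewrite /contract; case: ifP; rewrite ?ltxx // => kS /IH[//|T [kST cT wT]].
    exists T; split=> //; first exact: subset_trans (subsetUr _ _) kST.
    by rewrite cT cardsU1 kS addSnnS.
  move: p; rewrite /pder big1 ?ltxx // => k _.
  have := H k; rewrite lt_neqAle contract_ge0 // andbT => /negbFE/eqP <-.
  by rewrite mulr0.
have [k kT kS] : exists2 k, k \in T & k \notin S.
  have /properP[_ [k kT kS]] : S \proper T.
    by rewrite properEcard ST cT -addn1 leq_add2l.
  by exists k.
rewrite /pder (bigD1 k) //= ltr_wpDr //.
  by apply: sumr_ge0 => i _; rewrite mulr_ge0 ?contract_ge0.
rewrite mulr_gt0 // /contract (negbTE kS); apply/IH => //.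
exists T; split=> //; first by rewrite subUset sub1set kT.
by rewrite cT cardsU1 kS addSnnS.
Qed.

Lemma hess_foldr_gt0 us w i j : List.Forall (fun u => forall i, 0 < u i) us ->
  (forall S, 0 <= w S) ->
  (0 < hess (foldr pder w us) i j <->
   i != j /\ exists T, [/\ i \in T, j \in T, #|T| = (size us).+2 & 0 < w T]).
Proof.
move=> us0 w0; rewrite hessE; case: eqVneq => [->|ij].
  by rewrite ltxx; split=> // -[].
rewrite foldr_pder_gt0 // cards2 ij add2n.
by split=> [[T []]|[_ [T [iT jT cT wT]]]];
  [rewrite subUset !sub1set => /andP[iT jT] cT wT; split=> //; exists T
  |exists T; rewrite subUset !sub1set iT jT].
Qed.

(** An exchange between [k |: S] and [k |: T] cannot move [k], which lies in both. *)
Lemma mconcave_contract k w d : mconcave w d.+1 -> mconcave (contract k w) d.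
Proof.
move=> [w0 wd wx]; split; first exact: contract_ge0.
  move=> S; rewrite /contract; case: ifP; rewrite ?ltxx // => kS /wd.
  by rewrite cardsU1 kS => -[].
move=> S T s; rewrite /contract; case: ifP; rewrite ?ltxx // => kS wS.
case: ifP; rewrite ?ltxx // => kT wT; rewrite inE => /andP[sT sS].
have sk : s != k by apply: contraFneq kS => <-.
have [|t tTS le] := wx _ _ s wS wT.
  by rewrite !inE (negbTE sk) (negbTE sT) sS.
move: tTS; rewrite !inE negb_or => /andP[/andP[tk tS]]; rewrite (negbTE tk) /= => tT.
exists t; first by rewrite inE tS tT.
rewrite !inE (eq_sym k t) (negbTE tk) (eq_sym k s) (negbTE sk) kS kT !andbF /=.
apply: le_trans le _; rewrite le_eqVlt; apply/orP; left; apply/eqP.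
congr (w _ * w _); apply/setP => x; rewrite !inE.
  by case: (eqVneq x k) => [->|]; rewrite ?(eq_sym k) ?(negbTE sk) ?orbT.
by case: (eqVneq x k) => [->|]; rewrite ?(eq_sym k) ?(negbTE tk) ?orbT.
Qed.

(** Exchanging [i] out of [{i, j}] against [{k, l}] brings in [k] or [l], one for each term of the
    maximum. *)
Lemma mconcave_pluecker w : mconcave w 2 -> pluecker (hess w).
Proof.
move=> [w0 wd wx] i j k l.
have h0 a b : 0 <= hess w a b by rewrite hessE; case: ifP.
have rhs0 : 0 <= Num.max (hess w i k * hess w j l) (hess w i l * hess w j k).
  by rewrite le_max mulr_ge0.
have [hij|] := ltP 0 (hess w i j); last first.
  by move=> le; rewrite (@le_anti _ _ (hess w i j) 0) ?h0 ?le // mul0r.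
have [hkl|] := ltP 0 (hess w k l); last first.
  by move=> le; rewrite (@le_anti _ _ (hess w k l) 0) ?h0 ?le // mulr0.
have [ik|ik] := eqVneq i k.
  by rewrite ik le_max (hessC w j k) [hess w k j * _]mulrC lexx orbT.
have [il|il] := eqVneq i l.
  by rewrite il le_max (hessC w j l) (hessC w l k) mulrC lexx.
move: hij hkl; rewrite (hessE w i j) (hessE w k l).
case: eqVneq => [_|ij wS]; first by rewrite ltxx.
case: eqVneq => [_|kl wT]; first by rewrite ltxx.
have [|t tTS le] := wx _ _ i wS wT.
  by rewrite !inE (negbTE ik) (negbTE il) eqxx.
move: tTS le; have -> : [set i; j] :\ i = [set j].
  by apply/setP => x; rewrite !inE; case: eqVneq => //= ->; rewrite (negbTE ij).
rewrite !inE negb_or => /andP[/andP[ti tj]] /orP[] /eqP te; rewrite te.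
  have -> : [set k; l] :\ k = [set l].
    by apply/setP => x; rewrite !inE; case: eqVneq => //= ->; rewrite (negbTE kl).
  move=> /le_trans; apply; rewrite le_max (hessE w i l) (hessE w j k).
  have -> : (j == k) = false by rewrite eq_sym -te (negbTE tj).
  rewrite (negbTE il).
  by rewrite [w (k |: _) * _]mulrC [k |: _]setUC lexx orbT.
have -> : [set k; l] :\ l = [set k].
  apply/setP => x; rewrite !inE; case: (eqVneq x l) => [->|] /=; last by rewrite orbF.
  by rewrite eq_sym (negbTE kl).
move=> /le_trans; apply; rewrite le_max (hessE w i k) (hessE w j l).
have -> : (j == l) = false by rewrite eq_sym -te (negbTE tj).
rewrite (negbTE ik).
by rewrite [w (l |: _) * _]mulrC [l |: _]setUC lexx.
Qed.

(** Take bases [S] containing [i, a] and [T] containing [j, b], and exchange [i] for some [t] in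
    [T]. If [t = j], then [S - i + j] joins [j] to [a], a neighbour of [i]; otherwise [T - t + i]
    contains both [i] and [j]. *)
Lemma mconcave_connected us w i j a b : mconcave w (size us).+2 ->
  List.Forall (fun u => forall i, 0 < u i) us ->
  let h := hess (foldr pder w us) in
  0 < h i a -> 0 < h j b -> 0 < h i j \/ exists2 k, 0 < h i k & 0 < h k j.
Proof.
move=> [w0 wd wx] us0 h.
have hP c d : 0 < h c d <-> c != d /\ exists T, [/\ c \in T, d \in T & 0 < w T].
  split=> [/hess_foldr_gt0|[cd [T [cT dT wT]]]].
    by case=> // cd [T [cT dT _ wT]]; split=> //; exists T.
  by apply/hess_foldr_gt0 => //; split=> //; exists T; rewrite (wd T).
move=> hia hjb; have [ij|ij] := eqVneq i j.
  by right; exists a => //; rewrite -ij /h hessC.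
move: (hia) (hjb) => /hP[ia [S [iS aS wS]]] /hP[jb [T [jT bT wT]]].
have [iT|iT] := boolP (i \in T); first by left; apply/hP; split=> //; exists T.
have [jS|jS] := boolP (j \in S); first by left; apply/hP; split=> //; exists S.
have [|t] := wx S T i wS wT; first by rewrite inE iT.
rewrite inE => /andP[tS tT] le.
have := lt_le_trans (mulr_gt0 wS wT) le.
have [->|wp] := eqVneq (w (t |: S :\ i)) 0; first by rewrite mul0r ltxx.
have {}wp : 0 < w (t |: S :\ i) by rewrite lt_def wp w0.
rewrite pmulr_rgt0 // => wq.
have [tj|tj] := eqVneq t j.
  right; exists a => //; apply/hP; split.
    by apply: contraNneq jS => <-.
  exists (t |: S :\ i); split=> //; rewrite !inE ?tj ?eqxx //.
  by rewrite aS (eq_sym a i) ia orbT.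
left; apply/hP; split=> //; exists (i |: T :\ t); split=> //; rewrite !inE.
  by rewrite eqxx.
by rewrite (eq_sym j t) tj jT orbT.
Qed.

(** Strictly positive directions serve both [mconcave_connected] and the division by [z] in
    [trickle_down]; [lorentzian_ge0] relaxes them by a limit. *)
Lemma lorentzian_pos us w : mconcave w (size us).+2 ->
  List.Forall (fun u => forall i, 0 < u i) us ->
  lorentzian (hess (foldr pder w us)).
Proof.
elim: us w => [|z us IH] w wM.
  move=> _; apply: pluecker_lorentzian.
  - exact: hessC.
  - by move=> i j; rewrite hessE; case: ifP; case: wM.
  - by move=> i; rewrite hessE eqxx.
  - exact: mconcave_pluecker.
move=> zus0; have /List.Forall_cons_iff[z0 us0] := zus0.
set G := foldr pder w us.
have hE : hess (foldr pder w (z :: us)) =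
    fun i j => \sum_k z k * hess (contract k G) i j.
  apply/boolp.funext => i; apply/boolp.funext => j.
  rewrite /hess /= !contract_pder; apply: eq_bigr => k _.
  by rewrite (contractC j k) (contractC i k).
have conn := mconcave_connected wM zus0.
rewrite hE in conn *; apply: trickle_down => //.
- by move=> i j k; rewrite /hess contractC [in RHS]contractC (contractC i j) contractC.
- by move=> i j k; apply: hessC.
- move=> i j k; rewrite /hess; do 3 apply: contract_ge0.
  by apply: foldr_pder_ge0 (Forall_pos_ge0 us0) _; case: wM.
- move=> k; rewrite /G contract_foldr; apply: IH => //.
  exact: mconcave_contract.
Qed.

Lemma le0_of_small (a b c : R) :
  (forall e, 0 < e -> a <= e * b + e ^+ 2 * c) -> a <= 0.
Proof.
move=> H; rewrite leNgt; apply/negP => a0.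
set s := a + `|b| + `|c|.
have s0 : 0 < s by rewrite /s -addrA ltr_wpDr // addr_ge0.
(* With this [e <= 1], the right-hand side is at most [e * (|b| + |c|) = a - e * a], which is less
   than [a]. *)
set e := a / s.
have e0 : 0 < e by rewrite divr_gt0.
have es : e * s = a by rewrite divfK // lt0r_neq0.
have e1 : e <= 1.
  by rewrite ler_pdivrMr // mul1r /s -addrA lerDl addr_ge0.
have := H e e0; apply/negP; rewrite -ltNge.
have b1 : e * b <= e * `|b| by rewrite ler_pM2l // ler_norm.
have c1 : e ^+ 2 * c <= e * `|c|.
  rewrite expr2 -mulrA ler_pM2l //.
  apply: le_trans (ler_norm _) _; rewrite normrM (gtr0_norm e0).
  by rewrite ler_piMl.
have : 0 < e * a by rewrite mulr_gt0.
move: es; rewrite /s !mulrDr; lra.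
Qed.

(** For fixed vectors the inequality is polynomial of degree 2 in [e], so [le0_of_small] takes the
    place of a topological limit. *)
Lemma lorentzian_lim (h0 h1 : X -> X -> R) :
  (forall e, 0 < e -> lorentzian (fun i j => h0 i j + e * h1 i j)) ->
  lorentzian h0.
Proof.
move=> H x u u0.
have E e y z : bil (fun i j => h0 i j + e * h1 i j) y z =
    bil h0 y z + e * bil h1 y z.
  rewrite /bil mulr_sumr -big_split /=; apply: eq_bigr => i _.
  rewrite /app [in RHS]mulrCA -mulrDr; congr (_ * _).
  by rewrite mulr_sumr -big_split /=; apply: eq_bigr => j _; ring.
rewrite -subr_le0.
apply: (@le0_of_small _
  (2 * bil h0 x u * bil h1 x u - bil h0 x x * bil h1 u u - bil h1 x x * bil h0 u u)
  (bil h1 x u ^+ 2 - bil h1 x x * bil h1 u u)) => e e0.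
have := H e e0 x u u0; rewrite !E; lra.
Qed.

(** Perturbing [u] to [u + e] moves it to the positive list [vs]. The Hessian is affine in [e], so
    [lorentzian_lim] applies. *)
Lemma lorentzian_ge0 us vs w : mconcave w (size us + size vs).+2%N ->
  List.Forall (fun u => forall i, 0 <= u i) us ->
  List.Forall (fun u => forall i, 0 < u i) vs ->
  lorentzian (hess (foldr pder w (us ++ vs))).
Proof.
elim: us vs => [|u us IH] vs wM; first by move=> _; apply: lorentzian_pos.
move=> /List.Forall_cons_iff[u0 us0] vs0.
set G := foldr pder w (us ++ vs).
apply: (@lorentzian_lim _ (hess (pder (fun=> 1) G))) => // e e0.
pose v i := u i + e.
have := IH (v :: vs); rewrite /= addnS -addSn => /(_ wM us0).
have vvs : List.Forall (fun u => forall i, 0 < u i) (v :: vs).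
  by apply/List.Forall_cons_iff; split=> // i; rewrite /v ltr_wpDl.
move=> /(_ vvs); congr lorentzian.
rewrite foldr_cat /= -pder_foldr -foldr_cat -/G.
apply/boolp.funext => i; apply/boolp.funext => j.
rewrite /hess !contract_pder /pder mulr_sumr -big_split /=.
by apply: eq_bigr => k _; rewrite /v; ring.
Qed.

(** * Ultra log-concavity of slice sums, duality and binomials *)

Definition ind (A : {set X}) (i : X) : R := (i \in A)%:R.

(** The factor [b!] counts the orders in which the elements of [U :\: S] are differentiated; in the
    induction any of the [b.+1] elements may come first. *)
Lemma foldr_pder_ind A b w S :
  foldr pder w (nseq b (ind A)) S = b`!%:R *
    \sum_(U : {set X} | [&& S \subset U, U :\: S \subset A & #|U :\: S| == b]) w U.
Proof.
elim: b S => [|b IH] S /=.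
  rewrite fact0 mul1r (big_pred1 S) // => U /=.
  rewrite cards_eq0 setD_eq0 eqEsubset andbC -andbA andbC.
  case US: (U \subset S); rewrite ?andbF //=.
  by move: US; rewrite -setD_eq0 => /eqP->; rewrite sub0set andbT.
rewrite /pder.
pose c k (U : {set X}) :=
  [&& k |: S \subset U, U :\: (k |: S) \subset A & #|U :\: (k |: S)| == b].
transitivity (\sum_k \sum_(U | [&& k \in A, k \notin S & c k U]) b`!%:R * w U).
  apply: eq_bigr => k _; rewrite /ind /contract.
  case: (k \in A) => /=; last by rewrite mul0r big_pred0.
  case: (k \in S) => /=; first by rewrite mulr0 big_pred0.
  by rewrite mul1r IH mulr_sumr.
rewrite (exchange_big_dep (fun U : {set X} =>
  [&& S \subset U, U :\: S \subset A & #|U :\: S| == b.+1])) /=; last first.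
  move=> k U _ /and3P[kA kS /and3P[]]; rewrite subUset sub1set => /andP[kU SU].
  have -> : U :\: S = k |: (U :\: (k |: S)).
    by apply/setP => x; rewrite !inE; case: eqVneq => //= ->; rewrite kU kS.
  move=> UA /eqP cU; rewrite SU subUset sub1set kA UA cardsU1 cU.
  by rewrite !inE eqxx /= add1n eqxx.
rewrite factS natrM -mulrA mulrC mulr_sumr mulr_suml.
apply: eq_bigr => U /and3P[SU UA /eqP cU].
rewrite (eq_bigl (mem (U :\: S))) ?sumr_const ?cU.
  by rewrite -[LHS]mulr_natr; ring.
move=> k; rewrite !inE /c.
case kS: (k \in S) => /=; first by rewrite andbF.
case kU: (k \in U); last by rewrite subUset sub1set kU andbF.
have kUS : k \in U :\: S by rewrite inE kS kU.
rewrite (subsetP UA _ kUS) subUset sub1set kU SU /=.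
have UE : U :\: (k |: S) = (U :\: S) :\ k.
  by apply/setP => x; rewrite !inE negb_or andbA.
rewrite UE (subset_trans (subD1set _ _) UA) /=.
by move: cU; rewrite (cardsD1 k) kUS add1n => -[->]; rewrite eqxx.
Qed.

(** The coefficient of [x^(d-b) y^b] when the degree [d] part of the polynomial of [w] is evaluated
    at [y] on [A] and at [x] on [~: A]. *)
Definition slice_sum w (A : {set X}) d b : R :=
  \sum_(S : {set X} | (#|S| == d) && (#|S :&: A| == b)) w S.

Lemma foldr_pder_split A a b w :
  foldr pder w (nseq a (ind (~: A)) ++ nseq b (ind A)) set0 =
  (a`! * b`!)%:R * slice_sum w A (a + b)%N b.
Proof.
rewrite foldr_cat foldr_pder_ind natrM -mulrA; congr (_ * _).
under eq_bigr do rewrite foldr_pder_ind.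
rewrite -mulr_sumr; congr (_ * _).
rewrite (exchange_big_dep (fun U : {set X} =>
  (#|U| == a + b)%N && (#|U :&: A| == b))) /=; last first.
  move=> T U; rewrite sub0set setD0 /= => /andP[TA /eqP cT] /and3P[TU UA /eqP cU].
  have UTE : U :\: T = U :&: A.
    apply/setP => x; rewrite !inE; case xU: (x \in U); rewrite ?andbF //= andbT.
    have [xT|xT] := boolP (x \in T).
      by have := subsetP TA _ xT; rewrite inE => /negbTE->.
    by have := subsetP UA x; rewrite !inE xT xU => ->.
  by rewrite -UTE -(cardsID T U) (setIidPr TU) cT cU !eqxx.
apply: eq_bigr => U /andP[/eqP cU /eqP cUA].
have cD : #|U :\: A| = a.
  by have := cardsID A U; rewrite cU cUA addnC => /addIn.
(* The intermediate set between [set0] and [U] is forced to be [U :\: A]. *)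
rewrite (big_pred1 (U :\: A)) // => T /=; rewrite sub0set setD0 /=.
apply/idP/eqP => [/andP[/andP[TA /eqP cT] /and3P[TU UA /eqP cUT]]|->].
  apply/eqP; rewrite eqEcard cT cD leqnn andbT.
  by apply/subsetP => x xT; have := subsetP TA _ xT; rewrite !inE => ->; rewrite (subsetP TU).
rewrite cD eqxx subsetDl setDDr setDv set0U subsetIr cUA eqxx !andbT.
by rewrite setDE subsetIr.
Qed.

(** Differentiate [n] times along [~: A] and [m] times along [A], then apply the Lorentzian
    inequality to [ind A] and [ind (~: A)]. *)
Lemma mconcave_ulc w A m n : mconcave w (m + n).+2%N ->
  (n`! * m.+2`!)%:R * slice_sum w A (m + n).+2%N m.+2 *
    ((n.+2`! * m`!)%:R * slice_sum w A (m + n).+2%N m) <=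
  ((n.+1`! * m.+1`!)%:R * slice_sum w A (m + n).+2%N m.+1) ^+ 2.
Proof.
move=> wM.
pose us := nseq n (ind (~: A)) ++ nseq m (ind A).
have ind0 B i : 0 <= ind B i by rewrite ler0n.
have us0 : List.Forall (fun u => forall i, 0 <= u i) (us ++ [::]).
  rewrite cats0 /us; elim: n {wM us} => [|a IH] /=; last exact: List.Forall_cons.
  by elim: m => [|b IH] //=; apply: List.Forall_cons.
have := @lorentzian_ge0 us [::] w.
rewrite size_cat !size_nseq addn0 addnC cats0 in us0 * => /(_ wM us0 (List.Forall_nil _)).
move=> /(_ (ind A) (ind (~: A)) (ind0 _)); rewrite !bil_hess.
pose P a b := foldr pder w (nseq a (ind (~: A)) ++ nseq b (ind A)).
have EA a b : pder (ind A) (P a b) = P a b.+1.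
  by rewrite /P !foldr_cat /= pder_foldr.
have EC a b : pder (ind (~: A)) (P a b) = P a.+1 b by [].
rewrite /us -/(P n m) !EC !EA /P !foldr_pder_split.
by rewrite !addnS !addSn (addnC n m).
Qed.

Lemma slice_sum_ulc w A d k : mconcave w d -> (0 < k < d)%N ->
  slice_sum w A d k.+1 * slice_sum w A d k.-1 * (k.+1 * (d - k).+1)%:R <=
  slice_sum w A d k ^+ 2 * (k * (d - k))%:R.
Proof.
case: k => // m + /= md.
have [n ->] : exists n, d = (m + n).+2.
  by exists (d - m.+2)%N; rewrite -!addSn subnKC.
have -> : ((m + n).+2 - m.+1)%N = n.+1 by rewrite subSS -addnS addKn.
move=> /(mconcave_ulc A).
set a := slice_sum _ _ _ _; set b := slice_sum _ _ _ _; set c := slice_sum _ _ _ _.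
(* The factor common to the factorials on both sides of [mconcave_ulc]. *)
pose f : R := (n`! * m`!)%:R ^+ 2 * (m.+1 * n.+1)%:R.
have f0 : 0 < f.
  by rewrite mulr_gt0 ?exprn_gt0 ?ltr0n ?muln_gt0 ?fact_gt0.
move=> H; rewrite -(ler_pM2r f0).
have -> : a * b * (m.+2 * n.+2)%:R * f =
    (n`! * m.+2`!)%:R * a * ((n.+2`! * m`!)%:R * b).
  by rewrite /f !factS !natrM; ring.
have -> : c ^+ 2 * (m.+1 * n.+1)%:R * f = ((n.+1`! * m.+1`!)%:R * c) ^+ 2.
  by rewrite /f !factS !natrM; ring.
exact: H.
Qed.

(** If [#|S| = #|~: A|], then [S :&: A] and [~: S :&: ~: A] have equal size, being the complements
    of [S :\: A] in [S] and in [~: A]. *)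
Lemma slice_sum_compl w A d b : #|~: A| = d ->
  slice_sum (fun S => w (~: S)) (~: A) #|A| b = slice_sum w A d b.
Proof.
move=> cA; rewrite /slice_sum (reindex_inj (inv_inj (@setCK X))) /=.
apply: eq_big => [S|S _]; last by rewrite setCK.
have -> : (#|~: S| == #|A|) = (#|S| == d).
  by rewrite -cA -(eqn_add2l #|S|) cardsC -(cardsC A) addnC eqn_add2r eq_sym.
case: eqP => //= cS; congr (_ == b).
have := cardsID A S; have := cardsID S (~: A).
rewrite cA cS setIC -setDE setDE => {1}<-.
by rewrite -setDE addnC (setIC (~: S)) -setDE => /addnI->.
Qed.

(** Matroid duality: complementation turns the exchange of [s] from [S] to [T] into one from [~: T]
    to [~: S]. *)
Lemma mconcave_compl w d d' : (d + d')%N = #|X| -> mconcave w d ->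
  mconcave (fun S => w (~: S)) d'.
Proof.
move=> dd [w0 wd wx]; split=> [//|S /wd cS|S T s wS wT sST].
  by apply/eqP; rewrite -(eqn_add2l d) dd -cS addnC cardsC.
have [|t] := wx _ _ s wT wS; first by move: sST; rewrite !inE negbK andbC.
rewrite !inE negbK andbC => tST le; exists t; first by rewrite inE.
rewrite mulrC; apply: le_trans le _.
rewrite mulrC le_eqVlt; apply/orP; left; apply/eqP.
move: tST sST; rewrite inE => /andP[tT tS] /andP[sT sS].
have ts : t != s by apply: contraNneq sT => <-.
congr (w _ * w _); apply/setP => x; rewrite !inE.
  case: (eqVneq x s) => [->|]; rewrite ?negb_or ?negb_and //=.
  by rewrite eq_sym ts.
case: (eqVneq x t) => [->|]; rewrite ?negb_or ?negb_and //=.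
by rewrite ts.
Qed.

(** The ratio [(N - k + 1) / (N - k)] decreases in [N]. *)
Lemma ulc_weaken (a b c : R) (k M N : nat) : 0 <= a * b -> (0 < k < M)%N ->
  (M <= N)%N ->
  a * b * (k.+1 * (M - k).+1)%:R <= c ^+ 2 * (k * (M - k))%:R ->
  a * b * (k.+1 * (N - k).+1)%:R <= c ^+ 2 * (k * (N - k))%:R.
Proof.
move=> ab /andP[k0 kM] MN H.
have Mk : (0 < (M - k))%N by rewrite subn_gt0.
have Mk' : (0 : R) < (M - k)%:R by rewrite ltr0n.
rewrite -(ler_pM2r Mk').
apply: (@le_trans _ _ (a * b * (k.+1 * (M - k).+1)%:R * (N - k)%:R)).
  rewrite -![_ * _%:R * _%:R]mulrA -!natrM ler_wpM2l // ler_nat -!mulnA.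
  by rewrite leq_mul2l /= !mulSn leq_add // ?leq_sub2r // mulnC.
have -> : c ^+ 2 * (k * (N - k))%:R * (M - k)%:R =
    c ^+ 2 * (k * (M - k))%:R * (N - k)%:R by rewrite !natrM; ring.
by rewrite ler_wpM2r.
Qed.

(** From the ratios of consecutive binomials, ['C(N, k)^2 / ('C(N, k+1) 'C(N, k-1))] equals
    [(k+1)(N-k+1) / (k(N-k))]. *)
Lemma ulc_binomial (a b c : R) (k N : nat) : (0 < k < N)%N ->
  a * b * (k.+1 * (N - k).+1)%:R <= c ^+ 2 * (k * (N - k))%:R ->
  a / 'C(N, k.+1)%:R * (b / 'C(N, k.-1)%:R) <= c ^+ 2 / 'C(N, k)%:R ^+ 2.
Proof.
case: k => // k /= kN H.
have bin_pos j : (j <= N)%N -> (0 : R) < 'C(N, j)%:R by rewrite ltr0n bin_gt0.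
have P0 := bin_pos _ kN; have B0 := bin_pos _ (ltnW kN).
have Q0 := bin_pos _ (ltnW (ltnW kN)).
have PE : k.+2%:R * 'C(N, k.+2)%:R = (N - k.+1)%:R * 'C(N, k.+1)%:R :> R.
  by rewrite -!natrM mul_bin_left.
have QE : (N - k.+1).+1%:R * 'C(N, k)%:R = k.+1%:R * 'C(N, k.+1)%:R :> R.
  by rewrite -!natrM subnSK ?mul_bin_left // ltnW.
set P := 'C(N, k.+2)%:R in P0 PE *; set B := 'C(N, k.+1)%:R in B0 PE QE *.
set Q := 'C(N, k)%:R in Q0 QE *.
rewrite mulf_div ler_pdivrMr ?mulr_gt0 // mulrAC ler_pdivlMr ?exprn_gt0 //.
have f0 : (0 : R) < (k.+2 * (N - k.+1).+1)%:R by rewrite ltr0n muln_gt0.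
rewrite -(ler_pM2r f0).
have -> : c ^+ 2 * (P * Q) * (k.+2 * (N - k.+1).+1)%:R =
    c ^+ 2 * (k.+1 * (N - k.+1))%:R * B ^+ 2.
  transitivity (c ^+ 2 * (k.+2%:R * P) * ((N - k.+1).+1%:R * Q)).
    by rewrite natrM; ring.
  by rewrite PE QE natrM; ring.
by rewrite mulrAC ler_wpM2r // sqr_ge0.
Qed.
End Derivatives.

(** * From bimatroids to slice sums *)

Section Bimatroid.
Variables (R : realType) (E F : finType).
Variables (mu : {set E} -> {set F} -> option R) (q : R).

(** The axioms constrain [bimatroid_nu mu] only on sets of size [#|E|], hence the cut-off. *)
Definition bweight (S : {set E + F}) : R :=
  if #|S| == #|E| then qpow q (bimatroid_nu mu S) else 0.

Lemma qpow_ge0 a : 0 <= qpow q a.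
Proof. by case: a => //= x; apply: powR_ge0. Qed.

Lemma qpowD a b : 0 < q -> qpow q (oadd a b) = qpow q a * qpow q b.
Proof.
move=> q0; case: a b => [a|] [b|] /=; rewrite ?mulr0 ?mul0r //.
by rewrite powRD // (gt_eqF q0) implybT.
Qed.

Lemma ole_qpow a b : 0 < q -> q <= 1 -> ole a b -> qpow q b <= qpow q a.
Proof.
move=> q0 q1; case: a b => [a|] [b|] //=; rewrite ?powR_ge0 // => ab.
by rewrite /powR (gt_eqF q0) ler_expR ler_wnM2r // ln_le0.
Qed.

Lemma mconcave_bweight (G : R -> Prop) : 0 < q -> q <= 1 ->
  valuated_matroid G #|E| (bimatroid_nu mu) -> mconcave bweight #|E|.
Proof.
move=> q0 q1 [_ [_ nux]]; split.
- by move=> S; rewrite /bweight; case: ifP => // _; apply: qpow_ge0.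
- by move=> S; rewrite /bweight; case: eqP; rewrite ?ltxx.
move=> S T s; rewrite /bweight.
case: eqP => [cS _|]; last by rewrite ltxx.
case: eqP => [cT _|]; last by rewrite ltxx.
move=> sST; have [t tTS le] := nux S T cS cT s sST; exists t => //.
have card_swap (A B : {set E + F}) a b : #|A| = #|E| -> a \in A :\: B ->
    b \in B :\: A -> #|b |: A :\ a| == #|E|.
  move=> cA; rewrite !inE => /andP[aB aA] /andP[bA bB].
  rewrite cardsU1 !inE (negbTE bA) andbF add1n.
  by move: cA; rewrite (cardsD1 a) aA add1n => ->.
rewrite (card_swap S T s t) ?(card_swap T S t s) // -!qpowD //.
exact: ole_qpow.
Qed.

Definition inrs : {set E + F} := [set inr f | f : F].

Definition bpair (p : {set E} * {set F}) : {set E + F} :=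
  [set x | match x with inl e => e \notin p.1 | inr f => f \in p.2 end].

(** Under the bijection [bpair], having size [#|E|] means [#|I| = #|J|], and this common size is the
    number of elements in [inrs]. *)
Lemma Rk_slice_sum k : Rk mu q k = slice_sum bweight inrs #|E| k.
Proof.
pose g (S : {set E + F}) := (~: (inl @^-1: S), inr @^-1: S).
have gK : cancel g bpair by move=> S; apply/setP => -[e|f]; rewrite !inE ?negbK.
have bK : cancel bpair g.
  by move=> [I J]; congr pair; apply/setP => x; rewrite !inE ?negbK.
rewrite /Rk pair_big /= /slice_sum (reindex bpair) /=; last first.
  by exists g => S _.
have card_bpair I J : #|bpair (I, J)| = (#|~: I| + #|J|)%N.
  rewrite -!sum1_card big_sumType /=.
  by congr (_ + _)%N; apply: eq_bigl => x; rewrite !inE.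
have card_bpairF I J : #|bpair (I, J) :&: inrs| = #|J|.
  rewrite -!sum1_card big_sumType /= big_pred0 ?add0n.
    by apply: eq_bigl => f; rewrite !inE imset_f ?andbT.
  by move=> e; rewrite !inE; apply/negbTE/nandP; right; apply/imsetP => -[].
have cond I J : (#|bpair (I, J)| == #|E|) && (#|bpair (I, J) :&: inrs| == k) =
    (#|I| == k) && (#|J| == k).
  rewrite card_bpair card_bpairF -(cardsC I) addnC eqn_add2r.
  by case: (eqVneq #|J| k) => [->|]; rewrite ?andbF // !andbT eq_sym.
apply: eq_big => [[I J]|[I J] /=]; first by rewrite cond.
rewrite -cond => /andP[cE _]; rewrite /bweight cE.
by rewrite /bimatroid_nu; case: (bK (I, J)) => -> ->.
Qed.

Lemma Rk_ge0 k : 0 <= Rk mu q k.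
Proof. by do 2 (apply: sumr_ge0 => ? _); apply: qpow_ge0. Qed.

Lemma Rk_eq0 k : (minn #|E| #|F| < k)%N -> Rk mu q k = 0.
Proof.
rewrite gtn_min => /orP[] lt; rewrite /Rk.
  by rewrite big_pred0 // => I; apply/negbTE; rewrite neq_ltn (leq_ltn_trans (max_card _)).
rewrite big1 // => I _; rewrite big_pred0 // => J.
by apply/negbTE; rewrite neq_ltn (leq_ltn_trans (max_card _)).
Qed.

Lemma Rk_ulc (G : R -> Prop) M k : 0 < q -> q <= 1 ->
  valuated_matroid G #|E| (bimatroid_nu mu) ->
  M = #|E| \/ M = #|F| -> (0 < k < M)%N ->
  Rk mu q k.+1 * Rk mu q k.-1 * (k.+1 * (M - k).+1)%:R <=
  Rk mu q k ^+ 2 * (k * (M - k))%:R.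
Proof.
move=> q0 q1 /(mconcave_bweight q0 q1) wM; rewrite !Rk_slice_sum.
have cF : #|inrs| = #|F| by rewrite card_imset //; apply: inr_inj.
have cX : (#|E| + #|F|)%N = #|{: E + F}| by rewrite card_sum.
have cE : #|~: inrs| = #|E|.
  by apply/eqP; rewrite -(eqn_add2l #|F|) -{1}cF cardsC -cX addnC.
case=> -> kM; first exact: slice_sum_ulc.
(* For [M = #|F|], pass to the dual weight, which has degree [#|F|] and the same slice sums. *)
rewrite -!(slice_sum_compl bweight _ cE) cF.
exact: slice_sum_ulc (mconcave_compl cX wM) kM.
Qed.
End Bimatroid.

Theorem theoremC (R : realType) (G : R -> Prop) (E F : finType)
    (mu : {set E} -> {set F} -> option R) (q : R) (N k : nat) :
  additive_subgroup G ->
  valuated_bimatroid G mu ->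
  0 < q -> q <= 1 ->
  (minn #|E| #|F| <= N)%N ->
  (1 <= k)%N -> (k.+1 <= N)%N ->
  (Rk mu q k) ^+ 2 / ('C(N, k)%:R) ^+ 2 >=
    (Rk mu q k.+1 / 'C(N, k.+1)%:R) * (Rk mu q k.-1 / 'C(N, k.-1)%:R).
Proof.
move=> _ [nuM _] q0 q1 MN k0 kN.
apply: ulc_binomial; first by rewrite k0.
(* From the minimum on, [Rk mu q k.+1] vanishes; below it, the inequality at the minimum is weakened
   to [N]. *)
have [kM|Mk] := ltnP k (minn #|E| #|F|); last first.
  by rewrite Rk_eq0 // !mul0r mulr_ge0 ?sqr_ge0.
apply: (@ulc_weaken R _ _ _ _ (minn #|E| #|F|)) => //.
- by rewrite mulr_ge0 ?Rk_ge0.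
- by rewrite k0.
apply: Rk_ulc nuM _ _ => //; last by rewrite k0.
by rewrite /minn; case: ifP; [left|right].
Qed.
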